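(* Let $P_1,\dots,P_n\in\mathbb{C}[t]$ be nonconstant polynomials with $P_i(0)=0$ for all $i$, let $\mu\in\mathbb{C}$, and let $$A=A_{P_1,\dots,P_n;\mu}=\mathbb{C}\langle x_1,\dots,x_n \mid P_i(x_i)=0\ (i=1,\dots,n),\ \textstyle\sum_{i=1}^n x_i=\mu e\rangle .$$ For each $i$ let $\alpha_{i0},\alpha_{i1},\dots,\alpha_{i,\deg P_i-1}$ be all roots of $P_i$, taken with multiplicities, in any order such that $\alpha_{i0}=0$. Let $Q=Q(A)$ be the star-shaped quiver with central vertex $c$ described in the context, and let $$\lambda=\sum_{i=1}^n\sum_{j=1}^{\deg P_i-1}(\alpha_{i,j-1}-\alpha_{ij})\,e_{ij}+\mu e_c .$$ Then $A$ is isomorphic to $e_c\Pi^\lambda(Q)e_c$ under the isomorphism sending $x_i$ to $a_{i1}a_{i1}^*$ for $i=1,\dots,n$.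
   Context: $A_{P_1,\dots,P_n;\mu}$ is a unital associative algebra with identity $e$. The quiver $Q(A)$ has vertex set $I=\{(i,j): i=1,\dots,n,\ j=1,\dots,\deg P_i-1\}\cup\{c\}$ and arrows $a_{ij}:(i,j)\to(i,j-1)$ for $i=1,\dots,n$, $j=1,\dots,\deg P_i-1$, where $(i,0)$ is identified with $c$ for every $i$. The trivial path at $(i,j)$ is denoted $e_{ij}$ and the trivial path at $c$ is denoted $e_c$. If $\deg P_i=1$ there is no arrow $a_{i1}$ and $a_{i1}a_{i1}^*$ is read as $0$. For a quiver $Q$ with finite vertex set $I$, the double quiver $\bar Q$ is obtained by adding a reverse arrow $a^*:j\to i$ for every arrow $a:i\to j$ of $Q$. $\mathbb{C}\bar Q$ is its path algebra, with basis the paths in $\bar Q$ including a trivial path $e_i$ for each vertex $i$; paths are composed like functions, so that an arrow $a:i\to j$ satisfies $a=e_jae_i$. For $\lambda=(\lambda_i)\in\mathbb{C}^I$, identified with $\sum_{i\in I}\lambda_ie_i$, the deformed preprojective algebra is $$\Pi^\lambda(Q)=\mathbb{C}\bar Q\Big/\Big(\sum_{a\in \mathrm{Arrows}(Q)}[a,a^*]-\lambda\Big),\qquad [a,a^*]=aa^*-a^*a,$$ the quotient being by the two-sided ideal generated by the displayed element. The algebra $e_c\Pi^\lambda(Q)e_c$ has identity element $e_c$. *)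

(* Defs.v *)
From HB Require Import structures.
From mathcomp Require Import all_boot all_order all_algebra.
From mathcomp Require Import finmap monalg boolp reals complex.

Set Implicit Arguments.
Unset Strict Implicit.
Unset Printing Implicit Defensive.

Import GRing.Theory.

Local Open Scope ring_scope.
Local Open Scope quotient_scope.

Section QuotientAlgebra.
Context (K : fieldType) (A : algType K) (S : A -> Prop).

Inductive gen_ideal : A -> Prop :=
| gen_ideal_mem x : S x -> gen_ideal x
| gen_ideal0 : gen_ideal 0
| gen_idealD x y : gen_ideal x -> gen_ideal y -> gen_ideal (x + y)
| gen_idealMl a x : gen_ideal x -> gen_ideal (a * x)
| gen_idealMr a x : gen_ideal x -> gen_ideal (x * a).

Lemma gen_idealN x : gen_ideal x -> gen_ideal (- x).
Proof. by move=> hx; rewrite -mulN1r; apply: gen_idealMl. Qed.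

Lemma gen_idealZ (k : K) x : gen_ideal x -> gen_ideal (k *: x).
Proof. by move=> hx; rewrite -[x]mul1r scalerAl; apply: gen_idealMl. Qed.

Definition ideal_rel : rel A := fun x y => `[< gen_ideal (x - y) >].

Lemma ideal_rel_equiv : equiv_class_of ideal_rel.
Proof.
split=> [x|x y|y x z /asboolP hxy /asboolP hyz].
- by apply/asboolP; rewrite subrr; apply: gen_ideal0.
- by apply/asboolP/asboolP => /gen_idealN; rewrite opprB.
- by apply/asboolP; rewrite -(subrKA y); apply: gen_idealD.
Qed.

Canonical ideal_equiv := EquivRelPack ideal_rel_equiv.
Canonical ideal_encModRel := defaultEncModRel ideal_rel.

Definition quot_alg := {eq_quot ideal_rel}.

HB.instance Definition _ : EqQuotient A ideal_rel quot_alg :=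
  EqQuotient.on quot_alg.
HB.instance Definition _ := Choice.on quot_alg.

Definition quot_pi (x : A) : quot_alg := \pi_quot_alg x.

Lemma quot_piP x y : quot_pi x = quot_pi y <-> gen_ideal (x - y).
Proof.
split=> [/eqP|h]; first by rewrite /quot_pi eqmodE => /asboolP.
by apply/eqP; rewrite /quot_pi eqmodE; apply/asboolP.
Qed.

Lemma quot_reprK x : gen_ideal (repr (quot_pi x) - x).
Proof. by apply/quot_piP; rewrite /quot_pi reprK. Qed.

Lemma quot_ind (P : quot_alg -> Prop) : (forall x, P (quot_pi x)) -> forall x, P x.
Proof. by move=> h x; rewrite -[x]reprK; apply: h. Qed.

Let qopp (x : quot_alg) := quot_pi (- repr x).
Let qadd (x y : quot_alg) := quot_pi (repr x + repr y).
Let qmul (x y : quot_alg) := quot_pi (repr x * repr y).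
Let qscale (k : K) (x : quot_alg) := quot_pi (k *: repr x).

Let qoppE x : qopp (quot_pi x) = quot_pi (- x).
Proof. by apply/quot_piP; rewrite -opprD; apply/gen_idealN/quot_reprK. Qed.

Let qaddE x y : qadd (quot_pi x) (quot_pi y) = quot_pi (x + y).
Proof. by apply/quot_piP; rewrite opprD addrACA; apply: gen_idealD; apply: quot_reprK. Qed.

Let qmulE x y : qmul (quot_pi x) (quot_pi y) = quot_pi (x * y).
Proof.
apply/quot_piP; set u := repr _; set v := repr _.
have -> : u * v - x * y = u * (v - y) + (u - x) * y.
  by rewrite mulrBr mulrBl subrKA.
by apply: gen_idealD; [apply: gen_idealMl|apply: gen_idealMr]; apply: quot_reprK.
Qed.

Let qscaleE k x : qscale k (quot_pi x) = quot_pi (k *: x).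
Proof. by apply/quot_piP; rewrite -scalerBr; apply/gen_idealZ/quot_reprK. Qed.

Let qaddA : associative qadd.
Proof.
elim/quot_ind=> x; elim/quot_ind=> y; elim/quot_ind=> z.
by rewrite !qaddE addrA.
Qed.

Let qaddC : commutative qadd.
Proof. by elim/quot_ind=> x; elim/quot_ind=> y; rewrite !qaddE addrC. Qed.

Let qadd0 : left_id (quot_pi 0) qadd.
Proof. by elim/quot_ind=> x; rewrite !qaddE add0r. Qed.

Let qaddN : left_inverse (quot_pi 0) qopp qadd.
Proof. by elim/quot_ind=> x; rewrite qoppE !qaddE addNr. Qed.

HB.instance Definition _ := GRing.isZmodule.Build quot_alg qaddA qaddC qadd0 qaddN.

Let qmulA : associative qmul.
Proof.
elim/quot_ind=> x; elim/quot_ind=> y; elim/quot_ind=> z.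
by rewrite !qmulE mulrA.
Qed.

Let qmul1l : left_id (quot_pi 1) qmul.
Proof. by elim/quot_ind=> x; rewrite !qmulE mul1r. Qed.

Let qmul1r : right_id (quot_pi 1) qmul.
Proof. by elim/quot_ind=> x; rewrite !qmulE mulr1. Qed.

Let qmulDl : left_distributive qmul +%R.
Proof.
elim/quot_ind=> x; elim/quot_ind=> y; elim/quot_ind=> z.
by rewrite /GRing.add /= !(qmulE, qaddE) mulrDl.
Qed.

Let qmulDr : right_distributive qmul +%R.
Proof.
elim/quot_ind=> x; elim/quot_ind=> y; elim/quot_ind=> z.
by rewrite /GRing.add /= !(qmulE, qaddE) mulrDr.
Qed.

(* The quotient may be the zero ring, hence only a pzRingType. *)
HB.instance Definition _ := GRing.Zmodule_isPzRing.Build quot_alg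
  qmulA qmul1l qmul1r qmulDl qmulDr.

Let qscaleA a b x : qscale a (qscale b x) = qscale (a * b) x.
Proof. by elim/quot_ind: x => x; rewrite !qscaleE scalerA. Qed.

Let qscale1 : left_id 1 qscale.
Proof. by elim/quot_ind=> x; rewrite !qscaleE scale1r. Qed.

Let qscaleDr : right_distributive qscale +%R.
Proof.
move=> k; elim/quot_ind=> x; elim/quot_ind=> y.
by rewrite /GRing.add /= !(qscaleE, qaddE) scalerDr.
Qed.

Let qscaleDl x : {morph qscale^~ x : a b / a + b}.
Proof.
elim/quot_ind: x => x a b.
by rewrite /GRing.add /= !(qscaleE, qaddE) scalerDl.
Qed.

HB.instance Definition _ := GRing.Zmodule_isLmodule.Build K quot_alg
  qscaleA qscale1 qscaleDr qscaleDl.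

Lemma quot_piD x y : quot_pi (x + y) = quot_pi x + quot_pi y.
Proof. by rewrite -qaddE. Qed.

Lemma quot_piM x y : quot_pi (x * y) = quot_pi x * quot_pi y.
Proof. by rewrite -qmulE. Qed.

Lemma quot_piZ k x : quot_pi (k *: x) = k *: quot_pi x.
Proof. by rewrite -qscaleE. Qed.

Lemma quot_scaleAl k (x y : quot_alg) : k *: (x * y) = (k *: x) * y.
Proof.
elim/quot_ind: x => x; elim/quot_ind: y => y.
by rewrite -quot_piM -!quot_piZ -quot_piM scalerAl.
Qed.

Lemma quot_scaleAr k (x y : quot_alg) : k *: (x * y) = x * (k *: y).
Proof.
elim/quot_ind: x => x; elim/quot_ind: y => y.
by rewrite -quot_piM -!quot_piZ -quot_piM scalerAr.
Qed.

(* e B e for an idempotent e of B = quot_alg; its identity is e. *)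
Section Corner.
Context (e : quot_alg) (eK : e * e = e).

Definition corner_pred : {pred quot_alg} :=
  fun x => `[< exists a, x = e * a * e >].

Record corner := Corner { corner_val : quot_alg; _ : corner_val \in corner_pred }.

HB.instance Definition _ := [isSub for corner_val].
HB.instance Definition _ := [Choice of corner by <:].

Let corner_submod : submod_closed corner_pred.
Proof.
split=> [|k x y /asboolP[a ->] /asboolP[b ->]]; apply/asboolP.
  by exists 0; rewrite mulr0 mul0r.
by exists (k *: a + b); rewrite mulrDr mulrDl -quot_scaleAr -quot_scaleAl.
Qed.

HB.instance Definition _ := GRing.isSubmodClosed.Build K quot_alg corner_pred
  (GRing.submod_closed_semi corner_submod).
HB.instance Definition _ := [SubChoice_isSubLmodule of corner by <:].

Let corner_predM : {in corner_pred &, forall x y, x * y \in corner_pred}.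
Proof.
move=> _ _ /asboolP[a ->] /asboolP[b ->]; apply/asboolP.
by exists (a * e * e * b); rewrite !mulrA.
Qed.

Let corner_predE : e \in corner_pred.
Proof. by apply/asboolP; exists e; rewrite !eK. Qed.

Definition corner_one : corner := Corner corner_predE.
Definition corner_mul (x y : corner) : corner :=
  Corner (corner_predM (valP x) (valP y)).

Let cmulA : associative corner_mul.
Proof. by move=> x y z; apply/val_inj; rewrite /= mulrA. Qed.

Let cmul1l : left_id corner_one corner_mul.
Proof. by case=> x hx; apply/val_inj => /=; case/asboolP: hx => a ->; rewrite !mulrA eK. Qed.

Let cmul1r : right_id corner_one corner_mul.
Proof. by case=> x hx; apply/val_inj => /=; case/asboolP: hx => a ->; rewrite -!mulrA eK. Qed.

Let cmulDl : left_distributive corner_mul +%R.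
Proof. by move=> x y z; apply/val_inj; rewrite /= mulrDl. Qed.

Let cmulDr : right_distributive corner_mul +%R.
Proof. by move=> x y z; apply/val_inj; rewrite /= mulrDr. Qed.

(* The alias carries the idempotency proof, on which the ring structure
   depends. *)
Definition corner_alg : Type := let _ := eK in corner.

HB.instance Definition _ := GRing.Lmodule.on corner_alg.
HB.instance Definition _ := GRing.Zmodule_isPzRing.Build corner_alg
  cmulA cmul1l cmul1r cmulDl cmulDr.

End Corner.
End QuotientAlgebra.

(* Vertices are required to exist so that path algebras are nonzero rings. *)
Record quiver := Quiver {
  vertex : finType;
  arrow : finType;
  qsrc : arrow -> vertex;
  qtgt : arrow -> vertex;
  quiver_inh : (0 < #|vertex|)%N
}.

Definition double (Q : quiver) : quiver :=
  @Quiver (vertex Q) (arrow Q + arrow Q)%type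
    (fun a => match a with inl b => qsrc b | inr b => qtgt b end)
    (fun a => match a with inl b => qtgt b | inr b => qsrc b end)
    (quiver_inh Q).

Section Paths.
Context (Q : quiver).

(* A path is its target together with its arrows a_1, ..., a_k written as in
   the product a_1 ... a_k: as for functions, a_k is travelled first. *)
Fixpoint is_path (v : vertex Q) (s : seq (arrow Q)) : bool :=
  if s is a :: s' then (qtgt a == v) && is_path (qsrc a) s' else true.

Record qpath : predArgType := QPath {
  qpath_val : vertex Q * seq (arrow Q);
  _ : is_path qpath_val.1 qpath_val.2
}.

HB.instance Definition _ := [isSub for qpath_val].
HB.instance Definition _ := [Choice of qpath by <:].

Definition path_tgt (p : qpath) : vertex Q := (val p).1.
Definition path_src (p : qpath) : vertex Q :=
  last (val p).1 (map (@qsrc Q) (val p).2).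

Lemma is_path_cat v s1 s2 :
  is_path v (s1 ++ s2) = is_path v s1 && is_path (last v (map (@qsrc Q) s1)) s2.
Proof. by elim: s1 v => //= a s1 IH v; rewrite IH andbA. Qed.

Definition path_triv (v : vertex Q) : qpath := @QPath (v, [::]) isT.

Lemma path_arrow_subproof (a : arrow Q) : is_path (qtgt a) [:: a].
Proof. by rewrite /= eqxx. Qed.

Definition path_arrow (a : arrow Q) : qpath :=
  @QPath (qtgt a, [:: a]) (path_arrow_subproof a).

Definition path_comp (p q : qpath) : option qpath :=
  if path_src p == path_tgt q then insub ((val p).1, (val p).2 ++ (val q).2)
  else None.

Lemma path_compN p q : path_src p != path_tgt q -> path_comp p q = None.
Proof. by rewrite /path_comp => /negPf->. Qed.

Lemma path_compP p q : path_src p = path_tgt q ->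
  exists r, [/\ path_comp p q = Some r,
    val r = ((val p).1, (val p).2 ++ (val q).2),
    path_tgt r = path_tgt p & path_src r = path_src q].
Proof.
case: p q => [[v s] hs] [[w t] ht] h; rewrite /path_comp h eqxx /=.
have hst : is_path v (s ++ t).
  by rewrite is_path_cat hs /=; move: h; rewrite /path_src /path_tgt /= => ->.
exists (@QPath (v, s ++ t) hst); split => //; first exact: insubT.
by move: h; rewrite /path_src /path_tgt /= map_cat last_cat => ->.
Qed.

End Paths.

Lemma bilinear_assoc (K : fieldType) (V : lmodType K) (T : Type) (b : T -> V)
    (M : V -> V -> V) :
    left_distributive M +%R -> right_distributive M +%R ->
    (forall k x y, M (k *: x) y = k *: M x y) ->
    (forall k x y, M x (k *: y) = k *: M x y) ->
    (forall P : V -> Prop, P 0 -> (forall x y, P x -> P y -> P (x + y)) ->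
       (forall k p, P (k *: b p)) -> forall x, P x) ->
    (forall p q r, M (b p) (M (b q) (b r)) = M (M (b p) (b q)) (b r)) ->
  associative M.
Proof.
move=> Dl Dr Zl Zr ind H.
have Ol x : M 0 x = 0 by have := Zl 0 0 x; rewrite !scale0r.
have Or x : M x 0 = 0 by have := Zr 0 x 0; rewrite !scale0r.
move=> x y z.
elim/ind: x => [|x1 x2 h1 h2|k p]; first by rewrite !Ol.
  by rewrite !Dl h1 h2.
rewrite !Zl; congr (_ *: _).
elim/ind: y => [|x1 x2 h1 h2|l q]; first by rewrite Ol !Or Ol.
  by rewrite Dl !Dr Dl h1 h2.
rewrite Zl !Zr Zl; congr (_ *: _).
elim/ind: z => [|x1 x2 h1 h2|m r]; first by rewrite !Or.
  by rewrite !Dr h1 h2.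
by rewrite !Zr H.
Qed.

Section PathAlgebra.
Context (K : fieldType) (Q : quiver).

Definition path_alg : Type := {malg K[qpath Q]}.

HB.instance Definition _ := GRing.Lmodule.on path_alg.

Definition of_path (p : qpath Q) : path_alg := mkmalgU p 1.

Definition basis_mul (p q : qpath Q) : path_alg :=
  if path_comp p q is Some r then of_path r else 0.

Definition path_mul_def (x y : path_alg) : path_alg :=
  \sum_(p <- msupp x) \sum_(q <- msupp y) (x@_p * y@_q) *: basis_mul p q.

Fact path_mul_key : unit. Proof. exact: tt. Qed.
Definition path_mul := locked_with path_mul_key path_mul_def.
Canonical path_mul_unlockable := [unlockable fun path_mul].

Definition path_one : path_alg := \sum_(v : vertex Q) of_path (path_triv v).

Local Open Scope fset_scope.

Let pmulw (d1 d2 : {fset qpath Q}) (x y : path_alg) :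
    msupp x `<=` d1 -> msupp y `<=` d2 ->
  path_mul x y = \sum_(p <- d1) \sum_(q <- d2) (x@_p * y@_q) *: basis_mul p q.
Proof.
move=> le1 le2; rewrite unlock (big_fset_incl _ le1) /=.
  apply: eq_bigr => p _; apply: big_fset_incl => // q _ /mcoeff_outdom ->.
  by rewrite mulr0 scale0r.
move=> p _ /mcoeff_outdom xp; rewrite big1 // => q _.
by rewrite xp mul0r scale0r.
Qed.

Let pmulDl : left_distributive path_mul +%R.
Proof.
move=> x y z.
pose d := msupp x `|` msupp y `|` msupp (x + y : path_alg).
have hx : msupp x `<=` d by rewrite /d -fsetUA fsubsetUl.
have hy : msupp y `<=` d.
  by apply: fsubset_trans (fsubsetUr (msupp x) _) (fsubsetUl _ _).
have hxy : msupp (x + y : path_alg) `<=` d by apply: fsubsetUr.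
have hz := fsubset_refl (msupp z).
rewrite (pmulw hx hz) (pmulw hy hz) (pmulw hxy hz).
rewrite -big_split /=; apply: eq_bigr => p _.
rewrite -big_split /=; apply: eq_bigr => q _.
by rewrite mcoeffD mulrDl scalerDl.
Qed.

Let pmulDr : right_distributive path_mul +%R.
Proof.
move=> z x y.
pose d := msupp x `|` msupp y `|` msupp (x + y : path_alg).
have hx : msupp x `<=` d by rewrite /d -fsetUA fsubsetUl.
have hy : msupp y `<=` d.
  by apply: fsubset_trans (fsubsetUr (msupp x) _) (fsubsetUl _ _).
have hxy : msupp (x + y : path_alg) `<=` d by apply: fsubsetUr.
have hz := fsubset_refl (msupp z).
rewrite (pmulw hz hx) (pmulw hz hy) (pmulw hz hxy).
rewrite -big_split /=; apply: eq_bigr => p _.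
rewrite -big_split /=; apply: eq_bigr => q _.
by rewrite mcoeffD mulrDr scalerDl.
Qed.

Let pmulZl k x y : path_mul (k *: x) y = k *: path_mul x y.
Proof.
pose d := msupp x `|` msupp (k *: x : path_alg).
have hx : msupp x `<=` d by apply: fsubsetUl.
have hkx : msupp (k *: x : path_alg) `<=` d by apply: fsubsetUr.
have hy := fsubset_refl (msupp y).
rewrite (pmulw hx hy) (pmulw hkx hy).
rewrite scaler_sumr; apply: eq_bigr => p _.
rewrite scaler_sumr; apply: eq_bigr => q _.
by rewrite mcoeffZ scalerA mulrA.
Qed.

Let pmulZr k x y : path_mul x (k *: y) = k *: path_mul x y.
Proof.
pose d := msupp y `|` msupp (k *: y : path_alg).
have hy : msupp y `<=` d by apply: fsubsetUl.
have hky : msupp (k *: y : path_alg) `<=` d by apply: fsubsetUr.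
have hx := fsubset_refl (msupp x).
rewrite (pmulw hx hy) (pmulw hx hky).
rewrite scaler_sumr; apply: eq_bigr => p _.
rewrite scaler_sumr; apply: eq_bigr => q _.
by rewrite mcoeffZ scalerA mulrCA.
Qed.

Let pmul0l : left_zero 0 path_mul.
Proof. by move=> x; have := pmulZl 0 0 x; rewrite !scale0r. Qed.

Let pmul0r : right_zero 0 path_mul.
Proof. by move=> x; have := pmulZr 0 x 0; rewrite !scale0r. Qed.

Let pmulUU p q : path_mul (of_path p) (of_path q) = basis_mul p q.
Proof.
rewrite (pmulw msuppU_le msuppU_le) !big_seq_fset1 !mcoeffUU.
by rewrite mulr1 scale1r.
Qed.

Lemma path_alg_ind (P : path_alg -> Prop) :
    P 0 -> (forall x y, P x -> P y -> P (x + y)%R) ->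
    (forall k p, P (k *: of_path p)) ->
  forall x, P x.
Proof.
move=> P0 PD PU x; rewrite [x]monalgE.
apply: (big_ind P) => // p _.
have -> : << x@_p *g p >> = x@_p *: of_path p.
  apply/malgP=> q; rewrite [RHS]mcoeffZ [LHS]mcoeffU /of_path.
  by rewrite mcoeffU mulrnAr mulr1.
exact: PU.
Qed.

Let pmulA : associative path_mul.
Proof.
apply: (@bilinear_assoc K path_alg _ of_path path_mul pmulDl pmulDr pmulZl pmulZr path_alg_ind) => p q r.
move: (pmul0l) (pmul0r) pmulUU; rewrite /basis_mul.
move: path_mul of_path (0 : path_alg) => M b z0 M0l M0r Mbb.
rewrite (Mbb q r) (Mbb p q).
have [hpq|hpq] := eqVneq (path_src p) (path_tgt q);
have [hqr|hqr] := eqVneq (path_src q) (path_tgt r).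
- have [u [-> uE ut us]] := path_compP hpq.
  have [v [-> vE vt vs]] := path_compP hqr.
  have hpv : path_src p = path_tgt v by rewrite vt.
  have hur : path_src u = path_tgt r by rewrite us.
  rewrite !Mbb.
  have [w [-> wE _ _]] := path_compP hpv.
  have [w' [-> wE' _ _]] := path_compP hur.
  by congr b; apply/val_inj/esym; rewrite /= wE' wE uE vE /= catA.
- have [u [-> uE ut us]] := path_compP hpq.
  by rewrite (path_compN hqr) M0r Mbb path_compN // us.
- have [v [-> vE vt vs]] := path_compP hqr.
  by rewrite (path_compN hpq) M0l Mbb path_compN // vt.
- by rewrite (path_compN hpq) (path_compN hqr) M0l M0r.
Qed.

Lemma path_comp_triv_l v (p : qpath Q) :
  path_comp (path_triv v) p = if v == path_tgt p then Some p else None.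
Proof.
have [h|h] := eqVneq v (path_tgt p); last by rewrite /path_comp (negPf h).
have [r [-> rE _ _]] := @path_compP Q (path_triv v) p h.
by congr Some; apply/val_inj; rewrite rE /= h /path_tgt -surjective_pairing.
Qed.

Lemma path_comp_triv_r v (p : qpath Q) :
  path_comp p (path_triv v) = if path_src p == v then Some p else None.
Proof.
have [h|h] := eqVneq (path_src p) v; last by rewrite /path_comp (negPf h).
have [r [-> rE _ _]] := @path_compP Q p (path_triv v) h.
by congr Some; apply/val_inj; rewrite rE /= cats0 -surjective_pairing.
Qed.

Let pmul1l : left_id path_one path_mul.
Proof.
elim/path_alg_ind => [|x y hx hy|k p].
- by rewrite pmul0r.
- by rewrite pmulDr hx hy.
rewrite pmulZr; congr (_ *: _); rewrite /path_one.
rewrite (big_morph (path_mul^~ _) (fun _ _ => pmulDl _ _ _) (pmul0l _)).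
rewrite (bigD1 (path_tgt p)) //= big1 => [|v hv].
  by rewrite addr0 pmulUU /basis_mul path_comp_triv_l eqxx.
by rewrite pmulUU /basis_mul path_comp_triv_l (negPf hv).
Qed.

Let pmul1r : right_id path_one path_mul.
Proof.
elim/path_alg_ind => [|x y hx hy|k p].
- by rewrite pmul0l.
- by rewrite pmulDl hx hy.
rewrite pmulZl; congr (_ *: _); rewrite /path_one.
rewrite (big_morph (path_mul _) (fun _ _ => pmulDr _ _ _) (pmul0r _)).
rewrite (bigD1 (path_src p)) //= big1 => [|v hv].
  by rewrite addr0 pmulUU /basis_mul path_comp_triv_r eqxx.
by rewrite pmulUU /basis_mul path_comp_triv_r eq_sym (negPf hv).
Qed.

Let pone_neq0 : path_one != 0.
Proof.
have /card_gt0P[v _] := quiver_inh Q.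
apply/eqP => h; have: of_path (path_triv v) = 0.
  by rewrite -(pmul1r (of_path (path_triv v))) h; apply: pmul0r.
move/malgP/(_ (path_triv v))/eqP; rewrite mcoeffUU mcoeff0 oner_eq0 //.
Qed.

HB.instance Definition _ := GRing.Zmodule_isNzRing.Build path_alg
  pmulA pmul1l pmul1r pmulDl pmulDr pone_neq0.

Let pscaleAl (k : K) (x y : path_alg) : k *: (x * y) = (k *: x) * y.
Proof. by rewrite /GRing.mul /= pmulZl. Qed.

HB.instance Definition _ := GRing.Lmodule_isLalgebra.Build K path_alg pscaleAl.

Let pscaleAr (k : K) (x y : path_alg) : k *: (x * y) = x * (k *: y).
Proof. by rewrite /GRing.mul /= pmulZr. Qed.

HB.instance Definition _ := GRing.Lalgebra_isAlgebra.Build K path_alg pscaleAr.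

Lemma of_pathM p q :
  of_path p * of_path q = if path_comp p q is Some r then of_path r else 0.
Proof. exact: pmulUU. Qed.

Definition vtx (v : vertex Q) : path_alg := of_path (path_triv v).
Definition arr (a : arrow Q) : path_alg := of_path (path_arrow a).

Lemma vtxK v : vtx v * vtx v = vtx v.
Proof. by rewrite of_pathM path_comp_triv_l eqxx. Qed.

End PathAlgebra.

Section Preprojective.
Context (K : fieldType) (Q : quiver) (lam : vertex Q -> K).

Definition arr0 (a : arrow Q) : path_alg K (double Q) := arr K (inl a : arrow (double Q)).
Definition arr_star (a : arrow Q) : path_alg K (double Q) := arr K (inr a : arrow (double Q)).

Definition preproj_relator : path_alg K (double Q) :=
  \sum_(a : arrow Q) (arr0 a * arr_star a - arr_star a * arr0 a)
  - \sum_(v : vertex Q) lam v *: vtx K (v : vertex (double Q)).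

Definition preproj := quot_alg (fun x => x = preproj_relator).

Definition preproj_vtx (v : vertex Q) : preproj :=
  quot_pi _ (vtx K (v : vertex (double Q))).

Lemma preproj_vtxK v : preproj_vtx v * preproj_vtx v = preproj_vtx v.
Proof. by rewrite -quot_piM vtxK. Qed.

Definition preproj_corner (v : vertex Q) := corner_alg (preproj_vtxK v).

End Preprojective.

Section FreeAlgebra.
Context (K : fieldType) (n : nat).

Definition free_alg : Type := {malg K[{fmonom 'I_n}]}.

HB.instance Definition _ := GRing.Lalgebra.on free_alg.

Let malg_scaleAr (k : K) (x y : {malg K[{fmonom 'I_n}]}) :
  k *: (x * y) = x * (k *: y).
Proof.
have C : k%:MP * x = x * k%:MP :> {malg K[{fmonom 'I_n}]}.
  rewrite [LHS]malgM_def [RHS]malgM_def fgmulUg fgmulgU.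
  by apply: eq_bigr => m _; rewrite mulrC mul1m mulm1.
rewrite -[LHS]mul_malgC [LHS]mulrA C -[LHS]mulrA; congr (_ * _).
exact: mul_malgC.
Qed.

Let free_scaleAr (k : K) (x y : free_alg) : k *: (x * y) = x * (k *: y).
Proof. exact: malg_scaleAr. Qed.

HB.instance Definition _ := GRing.Lalgebra_isAlgebra.Build K free_alg free_scaleAr.

Definition free_gen (i : 'I_n) : free_alg := mkmalgU (fmu i) 1.

End FreeAlgebra.

Section PolyAlgebra.
Context (K : fieldType) (n : nat) (P : 'I_n -> {poly K}) (mu : K).

Variant polyA_rel (r : free_alg K n) : Prop :=
| polyA_rel_poly i of r = horner_alg (free_gen K i) (P i)
| polyA_rel_sum of r = \sum_(i < n) free_gen K i - mu%:A.

Definition polyA := quot_alg polyA_rel.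

Definition polyA_gen (i : 'I_n) : polyA := quot_pi _ (free_gen K i).

End PolyAlgebra.

Section StarQuiver.
Context (n : nat) (d : 'I_n -> nat).

(* The pair (i, k) with k < d i - 1 stands for the vertex (i, k + 1), and for
   the arrow a_{i,k+1}; None is the central vertex c. *)
Definition star_arrow : finType := {i : 'I_n & 'I_(d i).-1}.
Definition star_vertex : finType := option star_arrow.

Definition star_tgt (a : star_arrow) : star_vertex :=
  if tagged a == 0 :> nat then None
  else Some (Tagged (fun i => 'I_(d i).-1) (ord_pred (tagged a))).

Lemma star_inh : (0 < #|star_vertex|)%N.
Proof. by apply/card_gt0P; exists None. Qed.

Definition star_quiver : quiver := Quiver (@Some star_arrow) star_tgt star_inh.

Definition star_center : vertex star_quiver := None.

Context (K : fieldType) (alpha : 'I_n -> seq K) (mu : K).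

(* lambda_{ij} = alpha_{i,j-1} - alpha_{ij} with j = k + 1 *)
Definition star_weight (v : vertex star_quiver) : K :=
  if v is Some a then (alpha (tag a))`_(tagged a) - (alpha (tag a))`_(tagged a).+1
  else mu.

(* a_{i1} a_{i1}^*, read as 0 when there is no arrow a_{i1} *)
Definition star_aa (i : 'I_n) : preproj star_weight :=
  if insub 0%N is Some k then
    let a : arrow star_quiver := Tagged (fun i => 'I_(d i).-1) (k : 'I_(d i).-1) in
    quot_pi _ (arr0 K a * arr_star K a)
  else 0.

End StarQuiver.

(* Main.v *)
From HB Require Import structures.
Require Import Defs.
From mathcomp Require Import all_boot all_order all_algebra.
From mathcomp Require Import finmap monalg boolp reals complex ring.

Set Implicit Arguments.
Unset Strict Implicit.
Unset Printing Implicit Defensive.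

Import GRing.Theory.

Local Open Scope ring_scope.

(** Put [X_(i,j) = (x_i - alpha_i0) ... (x_i - alpha_i,j-1)] and [X_c = 1] in
    [A].

    The relations of [Pi^lambda] give the map from [A] to the corner.  Multiplied
    by [e_ij], the defining relation says
    [a_(j+1) a_(j+1)^* - a_j^* a_j = alpha_(j-1) - alpha_j], so moving
    [a_(j+1) a_(j+1)^*] past the path [a_j^* ... a_1^*] from [c] to [(i,j)] turns
    it, one step at a time, into [x - alpha_j] on the right of that path, where
    [x = a_1 a_1^*] ([climb_shift]); the induction starts because
    [alpha_i0 = 0].  Hence
    [a_1 ... a_j a_j^* ... a_1^* = X_(i,j)] evaluated at [x], and at the end of
    the branch, where there is no further arrow, the next factor gives
    [P_i(x) = 0] ([branch_annihilator]).  At [c] the relation says that the sum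
    of the [a_i1 a_i1^*] is [mu e_c].  So [x_i |-> a_i1 a_i1^*] is well defined
    ([center_free_eval_ideal]).

    It is surjective because every path starting at [c] is equal in [Pi^lambda]
    to a direct path [a_j^* ... a_1^*] times an element of the image: an arrow
    [a^*] lengthens the direct path, and an arrow [a_(j+1)], which follows the
    last step [a_(j+1)^*] of that path, produces a factor [x - alpha_j] by the
    rule above ([path_climb]).

    Injectivity comes from a representation of [Pi^lambda] by maps of right
    [A]-modules, with [X_v A], a submodule of [A], at the vertex [v]; the arrow
    [a_ij] acts as the inclusion of [X_(i,j) A] in [X_(i,j-1) A], and [a_ij^*] as
    left multiplication by [x_i - alpha_i,j-1].  The relation holds at the end of
    a branch because [(x_i - alpha_i,d-1) X_(i,d-1)] is a multiple of [P_i(x_i)].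
    As [X_c A = A], an element of the corner acts on it as an endomorphism of the
    right module [A], that is, as left multiplication by an element of [A], and
    this is the inverse map ([core_evalK]).  To avoid submodules, every operator
    is recorded by a matrix over [A] with rows and columns indexed by the
    vertices; such a matrix [M] acts as zero when [M v w * X_w = 0] for all [v],
    [w] ([rep_entry_ideal]). *)

(** * Linear maps on algebras with a basis and on quotients *)

Section LinearExtension.
Context (K : fieldType) (T : choiceType) (V : lmodType K) (b : T -> V).

Definition linext (x : {malg K[T]}) : V := \sum_(t <- msupp x) x@_t *: b t.

Lemma linextEw (s : {fset T}) x :
  (msupp x `<=` s)%fset -> linext x = \sum_(t <- s) x@_t *: b t.
Proof.
move=> le_s; rewrite /linext (big_fset_incl _ le_s) //= => t _.
by move/mcoeff_outdom->; rewrite scale0r.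
Qed.

Lemma linextU c t : linext << c *g t >> = c *: b t.
Proof. by rewrite (linextEw msuppU_le) big_seq_fset1 mcoeffUU. Qed.

Lemma linext_is_linear : linear linext.
Proof.
move=> k x y; pose s := (msupp x `|` msupp y `|` msupp (k *: x + y))%fset.
have sx : (msupp x `<=` s)%fset by rewrite /s -fsetUA fsubsetUl.
have sy : (msupp y `<=` s)%fset.
  exact: fsubset_trans (fsubsetUr (msupp x) _) (fsubsetUl _ _).
have sxy : (msupp (k *: x + y) `<=` s)%fset by apply: fsubsetUr.
rewrite (linextEw sx) (linextEw sy) (linextEw sxy) scaler_sumr -big_split /=.
by apply: eq_bigr => t _; rewrite mcoeffD mcoeffZ scalerDl scalerA.
Qed.

End LinearExtension.

Lemma malg_ind (K : fieldType) (T : choiceType) (C : {malg K[T]} -> Prop) :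
    C 0 -> (forall x y, C x -> C y -> C (x + y)) ->
    (forall k t, C (k *: << 1 *g t >>)) ->
  forall x, C x.
Proof.
move=> C0 CD CU x; rewrite [x]monalgE; apply: (big_ind C) => // t _.
have -> : << x@_t *g t >> = x@_t *: << 1 *g t >>.
  by apply/malgP=> u; rewrite mcoeffZ !mcoeffU mulrnAr mulr1.
exact: CU.
Qed.

Lemma malg_linear_ext (K : fieldType) (T : choiceType) (V : lmodType K)
    (f g : {malg K[T]} -> V) :
  linear f -> linear g -> (forall t, f << 1 *g t >> = g << 1 *g t >>) -> f =1 g.
Proof.
move=> lf lg eq_fg.
pose fL := GRing.isLinear.Build K _ V *:%R f lf.
pose gL := GRing.isLinear.Build K _ V *:%R g lg.
pose f' : {linear {malg K[T]} -> V} := HB.pack f fL.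
pose g' : {linear {malg K[T]} -> V} := HB.pack g gL.
have eq_fg' t : f' << 1 *g t >> = g' << 1 *g t >> by apply: eq_fg.
move=> x; rewrite -[f x]/(f' x) -[g x]/(g' x).
elim/malg_ind: x => [|x y hx hy|k t]; first by rewrite !linear0.
  by rewrite !linearD hx hy.
by rewrite !linearZ eq_fg'.
Qed.

Section QuotientLift.
Context (K : fieldType) (A : algType K) (S : A -> Prop) (V : lmodType K).
Context (F : {linear A -> V}).

Definition quot_lift (x : quot_alg S) : V := F (repr x).

Context (F_ideal : forall r, gen_ideal S r -> F r = 0).

Lemma quot_liftE a : quot_lift (quot_pi S a) = F a.
Proof.
by apply/eqP; rewrite -subr_eq0 -linearB; apply/eqP/F_ideal/quot_reprK.
Qed.

Lemma quot_lift_linear : linear quot_lift.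
Proof.
move=> k; elim/quot_ind=> x; elim/quot_ind=> y.
by rewrite -quot_piZ -quot_piD !quot_liftE linearP.
Qed.

End QuotientLift.

Section QuotientLinear.
Context (K : fieldType) (A : algType K) (S : A -> Prop).
Lemma quot_pi_is_linear : linear (quot_pi S).
Proof. by move=> k x y; rewrite quot_piD quot_piZ. Qed.
HB.instance Definition _ :=
  GRing.isLinear.Build K A (quot_alg S) *:%R (quot_pi S) quot_pi_is_linear.
Lemma quot_pi_is_monoid_morphism : monoid_morphism (quot_pi S).
Proof. by split=> // x y; rewrite quot_piM. Qed.
HB.instance Definition _ :=
  GRing.isMonoidMorphism.Build A (quot_alg S) (quot_pi S)
    quot_pi_is_monoid_morphism.
End QuotientLinear.

(** The quotient may be the zero ring, so it is not an algebra with [1 != 0], and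
    evaluation in it is the linear extension of the evaluation of words. *)
Section FreeEval.
Context (K : fieldType) (n : nat) (A : algType K) (S : A -> Prop).
Local Notation B := (quot_alg S).
Context (x : 'I_n -> B).

Definition free_eval (y : free_alg K n) : B :=
  linext (fun m : {fmonom 'I_n} => \prod_(i <- (m : seq 'I_n)) x i) y.

Lemma free_eval_is_linear : linear free_eval.
Proof. exact: linext_is_linear. Qed.
HB.instance Definition _ :=
  GRing.isLinear.Build K (free_alg K n) B *:%R free_eval free_eval_is_linear.

Definition free_monom (m : {fmonom 'I_n}) : free_alg K n := << 1 *g m >>.

Lemma free_eval_monom m :
  free_eval (free_monom m) = \prod_(i <- (m : seq 'I_n)) x i.
Proof. by rewrite /free_eval /free_monom linextU scale1r. Qed.

Lemma free_eval_gen i : free_eval (free_gen K i) = x i.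
Proof. by rewrite free_eval_monom fmuE big_seq1. Qed.

Lemma free_monomM m1 m2 :
  free_monom m1 * free_monom m2 = free_monom (mmul m1 m2).
Proof.
rewrite /free_monom.
suff: << 1 *g m1 >> * << 1 *g m2 >> = << 1 *g (mmul m1 m2) >> :> {malg K[{fmonom 'I_n}]} by [].
by rewrite malgM_def fgmulUU mulr1.
Qed.

Lemma free_evalD : {morph free_eval : y z / y + z}.
Proof. exact: linearD. Qed.

Lemma free_evalZ k : {morph free_eval : y / k *: y}.
Proof. exact: linearZ. Qed.

Lemma free_eval_is_monoid_morphism : monoid_morphism free_eval.
Proof.
split=> [|y z].
  have -> : 1 = free_monom (@mone _) by [].
  by rewrite free_eval_monom fm1 big_nil.
apply: (malg_linear_ext (f := fun y : free_alg K n => free_eval (y * z))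
  (g := fun y : free_alg K n => free_eval y * free_eval z)) => [k a b|k a b|m1].
- by rewrite mulrDl -scalerAl free_evalD free_evalZ.
- by rewrite free_evalD free_evalZ mulrDl quot_scaleAl.
apply: (malg_linear_ext
  (f := fun z : free_alg K n => free_eval (free_monom m1 * z))
  (g := fun z : free_alg K n => free_eval (free_monom m1) * free_eval z))
  => [k a b|k a b|m2].
- by rewrite mulrDr -scalerAr free_evalD free_evalZ.
- by rewrite free_evalD free_evalZ mulrDr quot_scaleAr.
by rewrite free_monomM !free_eval_monom fmM big_cat.
Qed.
HB.instance Definition _ :=
  GRing.isMonoidMorphism.Build (free_alg K n) B free_eval
    free_eval_is_monoid_morphism.

Lemma free_evalM : {morph free_eval : y z / y * z}.
Proof. exact: rmorphM. Qed.

End FreeEval.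

(** * Entries of a representation of a path algebra *)

Section PathRepresentation.
Context (K : fieldType) (Q : quiver) (A : algType K) (S : A -> Prop).
Local Notation B := (quot_alg S).
Context (wt : arrow Q -> B).

Definition path_wt (p : qpath Q) : B := \prod_(b <- (val p).2) wt b.

(** The matrix of [r] in the representation where the arrow [b] acts by left
    multiplication by [wt b] from the summand at its source to the summand at its
    target. *)
Definition rep_entry (v w : vertex Q) (r : path_alg K Q) : B :=
  linext (fun p => if (path_tgt p == v) && (path_src p == w)
                   then path_wt p else 0) r.

Lemma rep_entry_is_linear v w : linear (rep_entry v w).
Proof. exact: linext_is_linear. Qed.
HB.instance Definition _ v w :=
  GRing.isLinear.Build K (path_alg K Q) B *:%R (rep_entry v w)
    (rep_entry_is_linear v w).

Lemma rep_entryD v w : {morph rep_entry v w : r s / r + s}.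
Proof. exact: linearD. Qed.

Lemma rep_entryZ v w k : {morph rep_entry v w : r / k *: r}.
Proof. exact: linearZ. Qed.

Lemma rep_entry_path v w p :
  rep_entry v w (of_path K p) =
  if (path_tgt p == v) && (path_src p == w) then path_wt p else 0.
Proof. by rewrite /rep_entry linextU scale1r. Qed.

Lemma path_alg_linear_ext (V : lmodType K) (f g : path_alg K Q -> V) :
  linear f -> linear g -> (forall p, f (of_path K p) = g (of_path K p)) ->
  f =1 g.
Proof. exact: malg_linear_ext. Qed.

Lemma rep_entryM_path v w p q :
  rep_entry v w (of_path K p * of_path K q) =
  \sum_u rep_entry v u (of_path K p) * rep_entry u w (of_path K q).
Proof.
rewrite (bigD1 (path_src p)) //= big1 => [|u /negPf neq_u]; last first.
  by rewrite rep_entry_path eq_sym [_ == u]eq_sym neq_u andbF mul0r.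
rewrite addr0 of_pathM !rep_entry_path eqxx andbT.
have [eq_pq|neq_pq] := eqVneq (path_src p) (path_tgt q); last first.
  by rewrite (path_compN neq_pq) mulr0 linear0.
have [r [-> rE rt rs]] := path_compP eq_pq.
rewrite rep_entry_path rt rs /path_wt rE /= big_cat /=.
by case: (_ == v); case: (_ == w); rewrite ?mulr0 ?mul0r.
Qed.

Lemma rep_entryM v w r s :
  rep_entry v w (r * s) = \sum_u rep_entry v u r * rep_entry u w s.
Proof.
apply: (path_alg_linear_ext (f := fun r => rep_entry v w (r * s))
  (g := fun r => \sum_u rep_entry v u r * rep_entry u w s))
  => [k a b|k a b|p].
- by rewrite mulrDl -scalerAl rep_entryD rep_entryZ.
- rewrite scaler_sumr -big_split; apply: eq_bigr => u _.
  by rewrite rep_entryD rep_entryZ mulrDl quot_scaleAl.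
apply: (path_alg_linear_ext (f := fun s => rep_entry v w (of_path K p * s))
  (g := fun s => \sum_u rep_entry v u (of_path K p) * rep_entry u w s))
  => [k a b|k a b|q].
- by rewrite mulrDr -scalerAr rep_entryD rep_entryZ.
- rewrite scaler_sumr -big_split; apply: eq_bigr => u _.
  by rewrite rep_entryD rep_entryZ mulrDr quot_scaleAr.
exact: rep_entryM_path.
Qed.

Lemma rep_entry_vtx v w u :
  rep_entry v w (vtx K u) = if (u == v) && (u == w) then 1 else 0.
Proof. by rewrite rep_entry_path /path_wt big_nil. Qed.

Lemma rep_entry_arrM v w b b' : qsrc b = qtgt b' ->
  rep_entry v w (arr K b * arr K b') =
  if (qtgt b == v) && (qsrc b' == w) then wt b * wt b' else 0.
Proof.
move=> eq_bb; rewrite of_pathM.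
have [r [-> rE rt rs]] := path_compP (p := path_arrow b) (q := path_arrow b') eq_bb.
by rewrite rep_entry_path rt rs /path_wt rE /= big_cons big_seq1.
Qed.

Context (X : vertex Q -> B).
Context (wt_X : forall b, exists y, wt b * X (qsrc b) = X (qtgt b) * y).

Lemma path_wt_X p : exists y, path_wt p * X (path_src p) = X (path_tgt p) * y.
Proof.
case: p => [[v s] /= vs]; rewrite /path_wt /path_src /path_tgt /=.
elim: s v vs => [|b s IH] v /=; first by exists 1; rewrite big_nil mulr1 mul1r.
case/andP=> /eqP <- /IH[y yE]; have [z zE] := wt_X b.
by exists (z * y); rewrite big_cons -mulrA yE !mulrA zE.
Qed.

(** Every element of the path algebra maps the right ideal [X w * B] at [w] into
    the right ideal [X v * B] at [v]: these right ideals form a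
    subrepresentation. *)
Lemma rep_entry_X v w r : exists y, rep_entry v w r * X w = X v * y.
Proof.
elim/path_alg_ind: r => [|r s [y yE] [z zE]|k p].
- by exists 0; rewrite linear0 mulr0 mul0r.
- by exists (y + z); rewrite rep_entryD mulrDl yE zE mulrDr.
have [y yE] := path_wt_X p.
rewrite rep_entryZ rep_entry_path.
case: andP => [[/eqP <- /eqP <-]|_].
  by exists (k *: y); rewrite -quot_scaleAl yE quot_scaleAr.
by exists 0; rewrite scaler0 mulr0 mul0r.
Qed.

(** The elements acting as zero on the subrepresentation with [X v * B] at [v]
    form a two-sided ideal, so it is enough to test the generators. Closure under
    right multiplication is where stability of the subrepresentation is used. *)
Lemma rep_entry_ideal (I : path_alg K Q -> Prop) :
    (forall r, I r -> forall v w, rep_entry v w r * X w = 0) ->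
  forall r, gen_ideal I r -> forall v w, rep_entry v w r * X w = 0.
Proof.
move=> I0 r; elim=> {r} [r /I0 //||r s _ hr _ hs|a r _ hr|a r _ hr] v w.
- by rewrite linear0 mul0r.
- by rewrite rep_entryD mulrDl hr hs addr0.
- by rewrite rep_entryM mulr_suml big1 // => u _; rewrite -mulrA hr mulr0.
rewrite rep_entryM mulr_suml big1 // => u _.
by have [y yE] := rep_entry_X u w a; rewrite -mulrA yE mulrA hr mul0r.
Qed.

End PathRepresentation.

Section RelatorEntries.
Context (K : fieldType) (Q : quiver) (A : algType K) (S : A -> Prop).
Context (lam : vertex Q -> K) (wt : arrow (Defs.double Q) -> quot_alg S).

Lemma rep_entry_relator (v w : vertex Q) :
  rep_entry wt v w (preproj_relator lam) =
  if v == w then \sum_(a : arrow Q | qtgt a == v) wt (inl a) * wt (inr a)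
    - \sum_(a : arrow Q | qsrc a == v) wt (inr a) * wt (inl a) - lam v *: (1 : quot_alg S)
  else 0.
Proof.
have -> : rep_entry wt v w (preproj_relator lam) =
  \sum_(a : arrow Q) ((if (qtgt a == v) && (qtgt a == w) then wt (inl a) * wt (inr a) else 0)
    - (if (qsrc a == v) && (qsrc a == w) then wt (inr a) * wt (inl a) else 0))
  - \sum_(u : vertex Q) lam u *: (if (u == v) && (u == w) then 1 else 0 : quot_alg S).
  rewrite /preproj_relator linearB.
  congr (_ - _); rewrite linear_sum; apply: eq_bigr => u _.
    by rewrite [LHS]linearB; congr (_ - _); apply: rep_entry_arrM.
  by rewrite /= rep_entryZ rep_entry_vtx.
have [<-|neq_vw] := eqVneq v w.
  rewrite sumrB -!big_mkcond /=; congr (_ - _ - _).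
  - by apply: eq_bigl => a; rewrite andbb.
  - by apply: eq_bigl => a; rewrite andbb.
  rewrite (bigD1 v) //= eqxx big1 ?addr0 // => u /negPf->.
  by rewrite scaler0.
have neq u : (u == v) && (u == w) = false.
  by apply/negP => /andP[/eqP-> vw]; rewrite vw in neq_vw.
rewrite !big1 ?subr0 // => [u _|a _]; first by rewrite neq scaler0.
by rewrite !neq subr0.
Qed.

End RelatorEntries.

(** * Arrows and vertices of the star-shaped quiver *)

Section StarCombinatorics.
Context (n : nat) (d : 'I_n -> nat).
Local Notation Q := (star_quiver d).

(** The arrow [a_(i,k+1)], which has the same name as the vertex where it starts.
    The option lets the relations be stated in one form for the whole branch: past
    the end, sums over arrows get the value [0]. *)
Definition branch_arrow i k : option (star_arrow d) :=
  omap (fun j : 'I_(d i).-1 => Tagged (fun i => 'I_(d i).-1) j) (insub k).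

(** The vertex at distance [k] from the center on branch [i]. *)
Definition branch_vertex i k : vertex Q :=
  if k is k'.+1 then branch_arrow i k' else None.

Lemma branch_arrowE (a : star_arrow d) : branch_arrow (tag a) (tagged a) = Some a.
Proof. by case: a => i k; rewrite /branch_arrow valK. Qed.

Lemma branch_arrow_lt i k : (k < (d i).-1)%N ->
  exists2 a, branch_arrow i k = Some a & tag a = i /\ tagged a = k :> nat.
Proof.
move=> lt_k; exists (Tagged (fun i => 'I_(d i).-1) (Ordinal lt_k)) => //.
by rewrite /branch_arrow insubT.
Qed.

Lemma branch_arrow_ge i k : ((d i).-1 <= k)%N -> branch_arrow i k = None.
Proof. by move=> le_k; rewrite /branch_arrow insubF // ltnNge le_k. Qed.

Lemma star_tgt_eq_center (a : star_arrow d) :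
  (star_tgt a == None) = (tagged a == 0 :> nat).
Proof. by rewrite /star_tgt; case: ifP. Qed.

Lemma star_tgt_eq_arrow (a b : star_arrow d) :
  (star_tgt a == Some b) = (tag a == tag b) && (tagged a == (tagged b).+1 :> nat).
Proof.
case: a b => [i k] [j l]; rewrite /star_tgt /=.
have [->|k_neq0] := eqVneq (k : nat) 0%N; first by rewrite andbF.
have [eq_ij|neq_ij] := eqVneq i j; last first.
  by apply/negP => /eqP[eq_ij]; rewrite eq_ij eqxx in neq_ij.
subst j; rewrite (inj_eq Some_inj) eq_Tagged -val_eqE /=.
case: k k_neq0 => [[|k] /= lt_k] // _.
by rewrite eqSS modnDr modn_small // ltnW.
Qed.

Lemma star_tgtE (a : star_arrow d) :
  star_tgt a = branch_vertex (tag a) (tagged a).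
Proof.
case def_k: (tagged a : nat) => [|k] /=.
  by apply/eqP; rewrite star_tgt_eq_center def_k.
have lt_k : (k < (d (tag a)).-1)%N.
  by apply: leq_trans (ltn_ord (tagged a)); rewrite def_k.
have [b -> [tb kb]] := branch_arrow_lt lt_k.
by apply/eqP; rewrite star_tgt_eq_arrow kb def_k eqxx andbT tb.
Qed.

Lemma sum_branch_arrow (V : nmodType) (I : pred 'I_n) k (F : star_arrow d -> V) :
  \sum_(a : star_arrow d | I (tag a) && (tagged a == k :> nat)) F a =
  \sum_(i | I i) oapp F 0 (branch_arrow i k).
Proof.
transitivity (\sum_(i | I i) \sum_(j < (d i).-1 | j == k :> nat)
    F (Tagged (fun i => 'I_(d i).-1) j)).
  by rewrite sig_big_dep; apply: eq_bigr => -[].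
apply: eq_bigr => i _; rewrite /branch_arrow.
case: insubP => [j _ <-|le_mk] /=; first by rewrite big_pred1_eq.
rewrite big_pred0 // => j; apply/eqP => eq_jk.
by rewrite -eq_jk ltn_ord in le_mk.
Qed.

Lemma sum_tgt_center (V : nmodType) (F : arrow Q -> V) :
  \sum_(a | @qtgt Q a == None) F a = \sum_i oapp F 0 (branch_arrow i 0).
Proof.
rewrite -(sum_branch_arrow xpredT); apply: eq_bigl => a.
exact: star_tgt_eq_center.
Qed.

Lemma sum_tgt_arrow (V : nmodType) (F : arrow Q -> V) (b : star_arrow d) :
  \sum_(a | @qtgt Q a == Some b) F a =
  oapp F 0 (branch_arrow (tag b) (tagged b).+1).
Proof.
transitivity (\sum_(i | i == tag b) oapp F 0 (branch_arrow i (tagged b).+1)).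
  rewrite -(sum_branch_arrow (pred1 (tag b))); apply: eq_bigl => a.
  exact: star_tgt_eq_arrow.
by rewrite big_pred1_eq.
Qed.

Lemma sum_src_center (V : nmodType) (F : arrow Q -> V) :
  \sum_(a | @qsrc Q a == None) F a = 0.
Proof. exact: big_pred0. Qed.

Lemma sum_src_arrow (V : nmodType) (F : arrow Q -> V) (b : star_arrow d) :
  \sum_(a | @qsrc Q a == Some b) F a = F b.
Proof. exact: big_pred1_eq. Qed.

End StarCombinatorics.

(** * Relations along one branch *)

(** One branch of the star, with [m] arrows: [up k] and [down k] stand for
    [a_(k+1)^*] and [a_(k+1)], [E] for the idempotent of the center, [e k] for the
    one at distance [k + 1], and [s k] for the scalar [alpha_k]. The relation at
    the end of the branch is the case [k = m - 1] of [branch_rel], in which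
    [up m] is zero. *)
Section BranchRelations.
Context (B : pzRingType) (m : nat) (E : B) (up down e s : nat -> B).
Context (E_idem : E * E = E).
Context (s_central : forall k y, s k * y = y * s k).
Context (s0 : s 0 = 0).
Context (loop_comm : down 0 * up 0 * E = E * (down 0 * up 0)).
Context (branch_rel : forall k, (k < m)%N ->
  down k.+1 * up k.+1 - up k * down k = (s k - s k.+1) * e k).
Context (e_up : forall k, (k < m)%N -> e k * up k = up k).
Context (up_end : up m = 0).

Fixpoint climb k := if k is k'.+1 then up k' * climb k' else E.
Fixpoint descend k := if k is k'.+1 then descend k' * down k' else E.

(** Induction along the branch: the relation at distance [k + 1] trades
    [down k.+1 * up k.+1] for [up k * down k] up to a scalar, and the scalars
    telescope to [s k]. *)
Lemma climb_shift k : (k <= m)%N ->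
  down k * up k * climb k = climb k * (down 0 * up 0 - s k).
Proof.
elim: k => [|k IH] lt_k /=; first by rewrite s0 subr0.
rewrite -[down k.+1 * up k.+1](subrK (up k * down k)) branch_rel // mulrDl.
have -> : up k * down k * (up k * climb k) =
    up k * (climb k * (down 0 * up 0 - s k)).
  by rewrite -IH 1?ltnW // !mulrA.
rewrite -mulrA [e k * _]mulrA e_up // mulrA.
have -> : (s k - s k.+1) * up k * climb k = up k * climb k * (s k - s k.+1).
  by rewrite -mulrA mulrBl !s_central mulrBr.
by rewrite [up k * (_ * _)]mulrA -mulrDr addrCA [s k - _]addrC addrAC subrK.
Qed.

Lemma descend_climb k : (k <= m.+1)%N ->
  descend k * climb k = E * \prod_(j < k) (down 0 * up 0 - s j).
Proof.
elim: k => [|k IH] lt_k /=; first by rewrite big_ord0 mulr1.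
rewrite big_ord_recr /= [RHS]mulrA -IH 1?ltnW //.
by rewrite -!mulrA [down k * (_ * _)]mulrA climb_shift.
Qed.

(** The path of length [m + 1] up the branch is zero, since [up m = 0]. *)
Lemma branch_annihilator : E * \prod_(j < m.+1) (down 0 * up 0 - s j) = 0.
Proof. by rewrite -descend_climb //= up_end mul0r mulr0. Qed.

End BranchRelations.

(** * Relations of the preprojective algebra at each vertex *)

Section PathAlgebraArrows.
Context (K : fieldType) (Q : quiver).

Lemma vtx_arr v (b : arrow Q) :
  vtx K v * arr K b = if v == qtgt b then arr K b else 0.
Proof. by rewrite of_pathM path_comp_triv_l; case: eqP. Qed.

Lemma arr_vtx v (b : arrow Q) :
  arr K b * vtx K v = if qsrc b == v then arr K b else 0.
Proof.
rewrite of_pathM path_comp_triv_r.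
by rewrite -[path_src (path_arrow b)]/(qsrc b); case: (_ == v).
Qed.

Lemma vtxM (u v : vertex Q) : vtx K u * vtx K v = if u == v then vtx K v else 0.
Proof. by rewrite of_pathM path_comp_triv_l; case: eqP. Qed.

End PathAlgebraArrows.

Section PreprojectiveArrows.
Context (K : fieldType) (Q : quiver) (lam : vertex Q -> K).
Local Notation B := (preproj lam).

Definition preproj_arr (a : arrow Q) : B := quot_pi _ (arr0 K a).
Definition preproj_star (a : arrow Q) : B := quot_pi _ (arr_star K a).

(** The component of the defining relation at [v], obtained by multiplying it by
    the idempotent of [v] on the left. *)
Lemma preproj_relation (v : vertex Q) :
  \sum_(a | qtgt a == v) preproj_arr a * preproj_star a
    - \sum_(a | qsrc a == v) preproj_star a * preproj_arr a =
  lam v *: preproj_vtx lam v.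
Proof.
pose T := \sum_(a : arrow Q | qtgt a == v) arr0 K a * arr_star K a.
pose U := \sum_(a : arrow Q | qsrc a == v) arr_star K a * arr0 K a.
have relE : vtx K (v : vertex (Defs.double Q)) * preproj_relator lam =
    T - U - lam v *: vtx K (v : vertex (Defs.double Q)).
  rewrite /preproj_relator [LHS]mulrBr; congr (_ - _).
    rewrite /T /U [X in _ = X - _]big_mkcond [X in _ = _ - X]big_mkcond -sumrB.
    rewrite [LHS]mulr_sumr; apply: eq_bigr => a _; rewrite [LHS]mulrBr.
    congr (_ - _); rewrite [LHS]mulrA [X in X * _]vtx_arr /= [v == _]eq_sym.
      by case: (qtgt a == v); rewrite // [LHS]mul0r.
    by case: (qsrc a == v); rewrite // [LHS]mul0r.
  rewrite [LHS]mulr_sumr (bigD1 v) //= big1 => [|u /negPf neq_u]; last first.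
    by rewrite -[LHS]scalerAr [X in _ *: X]vtxM eq_sym neq_u scaler0.
  by rewrite [LHS]addr0 -[LHS]scalerAr [X in _ *: X]vtxM eqxx.
have <- : quot_pi (fun r => r = preproj_relator lam) (T - U) =
    lam v *: preproj_vtx lam v.
  rewrite -quot_piZ; apply/quot_piP; rewrite -relE.
  by apply: gen_idealMl; apply: gen_ideal_mem.
rewrite [RHS]linearB; congr (_ - _); rewrite [RHS]linear_sum.
  by apply: eq_bigr => a _; rewrite [RHS]quot_piM.
by apply: eq_bigr => a _; rewrite [RHS]quot_piM.
Qed.

Lemma preproj_vtx_arr v a : preproj_vtx lam v * preproj_arr a =
  if v == qtgt a then preproj_arr a else 0.
Proof.
by rewrite -[LHS]quot_piM vtx_arr (fun_if (quot_pi _)).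
Qed.

Lemma preproj_vtx_star v a : preproj_vtx lam v * preproj_star a =
  if v == qsrc a then preproj_star a else 0.
Proof. by rewrite -[LHS]quot_piM vtx_arr (fun_if (quot_pi _)). Qed.

Lemma preproj_star_vtx v a : preproj_star a * preproj_vtx lam v =
  if qtgt a == v then preproj_star a else 0.
Proof. by rewrite -[LHS]quot_piM arr_vtx (fun_if (quot_pi _)). Qed.

End PreprojectiveArrows.

(** * The representation on right ideals of A *)

(** Over a field [K] the [P i] are assumed to split; [c i] is the leading
    coefficient of [P i]. *)
Section StarCorner.
Context (K : fieldType) (n : nat) (d : 'I_n -> nat) (P : 'I_n -> {poly K}).
Context (mu : K) (alpha : 'I_n -> seq K) (c : 'I_n -> K).
Context (d_gt0 : forall i, (0 < d i)%N).
Context (c_neq0 : forall i, c i != 0).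
Context (P_fact : forall i,
  P i = c i *: \prod_(j < d i) ('X - ((alpha i)`_j)%:P)).
Context (alpha0 : forall i, (alpha i)`_0 = 0).

Local Notation A := (polyA P mu).
Local Notation Q := (star_quiver d).
Local Notation Qd := (Defs.double Q).
Local Notation lam := (star_weight (d := d) alpha mu).

Definition partial_poly i k : {poly K} := \prod_(j < k) ('X - ((alpha i)`_j)%:P).

Lemma partial_polyS i k :
  partial_poly i k.+1 = partial_poly i k * ('X - ((alpha i)`_k)%:P).
Proof. by rewrite /partial_poly big_ord_recr. Qed.

(** Evaluation of polynomials at [x_i]. Elements of this form commute, which is
    needed because [X_(i,k+1)] has to be both a left and a right multiple of
    [X_(i,k)]. *)
Definition gen_horner i : {poly K} -> A :=
  quot_pi _ \o horner_alg (free_gen K i).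

HB.instance Definition _ i := GRing.RMorphism.on (gen_horner i).

Lemma gen_hornerX i : gen_horner i 'X = polyA_gen P mu i.
Proof. by rewrite /gen_horner /= horner_algX. Qed.

Lemma gen_hornerC i a : gen_horner i a%:P = a *: (1 : A).
Proof. by rewrite /gen_horner /= horner_algC quot_piZ. Qed.

Lemma gen_hornerM i : {morph gen_horner i : p q / p * q}.
Proof. exact: rmorphM. Qed.

Lemma gen_hornerB i : {morph gen_horner i : p q / p - q}.
Proof. exact: rmorphB. Qed.

Lemma gen_horner_full i : gen_horner i (partial_poly i (d i)) = 0.
Proof.
have: gen_horner i (P i) = 0.
  rewrite /gen_horner /=; apply/quot_piP; rewrite subr0.
  by apply/gen_ideal_mem; left with i.
rewrite P_fact -mul_polyC rmorphM /= gen_hornerC -quot_scaleAl mul1r.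
by move/eqP; rewrite scaler_eq0 (negPf (c_neq0 i)) => /eqP.
Qed.

Lemma sum_polyA_gen : \sum_i polyA_gen P mu i = mu *: (1 : A).
Proof.
rewrite -[X in X = _]/(\sum_i quot_pi _ _) -linear_sum.
rewrite -[1](rmorph1 (quot_pi (polyA_rel P mu))) -quot_piZ.
by apply/quot_piP; apply/gen_ideal_mem; right.
Qed.

Definition step_poly (a : star_arrow d) : {poly K} :=
  'X - ((alpha (tag a))`_(tagged a))%:P.

Definition star_wt (b : arrow Qd) : A :=
  match b with inl _ => 1 | inr a => gen_horner (tag a) (step_poly a) end.

Definition vertex_poly (v : vertex Q) : A :=
  if v is Some a then gen_horner (tag a) (partial_poly (tag a) (tagged a).+1)
  else 1.

(** [vertex_poly v] is the element [X_v] generating the right ideal at [v]; at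
    the center it is the empty product, whatever the branch. *)
Lemma vertex_poly_branch i k : (k < d i)%N ->
  vertex_poly (branch_vertex d i k) = gen_horner i (partial_poly i k).
Proof.
case: k => [|k] lt_k /=; first by rewrite /partial_poly big_ord0 rmorph1.
have lt_k' : (k < (d i).-1)%N by rewrite -ltnS prednK.
by have [a -> [ta ka]] := branch_arrow_lt lt_k'; rewrite /= ka ta.
Qed.

Lemma vertex_poly_tgt (a : arrow Q) :
  vertex_poly (qtgt a) = gen_horner (tag a) (partial_poly (tag a) (tagged a)).
Proof.
rewrite /= star_tgtE vertex_poly_branch //.
exact: leq_trans (ltn_ord (tagged a)) (leq_pred _).
Qed.

Lemma vertex_poly_src (a : arrow Q) :
  vertex_poly (qsrc a) =
  gen_horner (tag a) (partial_poly (tag a) (tagged a) * step_poly a).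
Proof. by rewrite /= partial_polyS. Qed.

Lemma star_wt_vertex_poly (b : arrow Qd) :
  exists y, star_wt b * vertex_poly (qsrc b) = vertex_poly (qtgt b) * y.
Proof.
case: b => a; rewrite [qsrc _]/= [qtgt _]/=.
  exists (gen_horner (tag a) (step_poly a)).
  by rewrite vertex_poly_src vertex_poly_tgt mul1r gen_hornerM.
exists 1; rewrite vertex_poly_src vertex_poly_tgt [RHS]mulr1 [star_wt _]/=.
by rewrite -gen_hornerM [X in gen_horner _ X]mulrC.
Qed.

(** At the end of the branch there is no arrow and the left side is [0]; the right
    side is a multiple of [P_i(x_i)], hence also [0]. *)
Lemma branch_arrow_wt i k : (k < d i)%N ->
  oapp (fun a => star_wt (inl a) * star_wt (inr a)) 0 (branch_arrow d i k)
    * gen_horner i (partial_poly i k) =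
  gen_horner i ('X - ((alpha i)`_k)%:P) * gen_horner i (partial_poly i k).
Proof.
rewrite leq_eqVlt => /orP[/eqP eq_k|lt_k].
  have -> : branch_arrow d i k = None by rewrite branch_arrow_ge -?eq_k.
  rewrite [LHS]mul0r -gen_hornerM.
  rewrite [X in gen_horner _ X]mulrC -partial_polyS eq_k.
  by rewrite gen_horner_full.
have lt_k' : (k < (d i).-1)%N by rewrite -ltnS prednK.
have [a -> [ta ka]] := branch_arrow_lt lt_k'.
by rewrite /= [1 * _]mul1r /step_poly ka ta.
Qed.

Lemma loop_wt i :
  oapp (fun a => star_wt (inl a) * star_wt (inr a)) 0 (branch_arrow d i 0) =
  polyA_gen P mu i.
Proof.
have := branch_arrow_wt (d_gt0 i).
rewrite /partial_poly big_ord0 rmorph1 !mulr1 => ->.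
by rewrite alpha0 subr0 gen_hornerX.
Qed.

(** The relations of [Pi^lambda] hold on the right ideals. On a branch the two
    terms [x_i - alpha_(k+1)] and [x_i - alpha_k] differ by the weight of the
    vertex; at the center the relation is [sum_polyA_gen]. *)
Lemma star_relator_entries v w :
  rep_entry star_wt v w (preproj_relator lam) * vertex_poly w = 0.
Proof.
rewrite (rep_entry_relator lam star_wt v w).
have [<-|_] := eqVneq v w; last by rewrite mul0r.
case: v => [b|].
  rewrite [X in (X - _ - _) * _]sum_tgt_arrow.
  rewrite [X in (_ - X - _) * _]sum_src_arrow.
  have cancel (B : pzRingType) (x y z t u : B) :
      x * u = t * u -> t - y - z = 0 -> (x - y - z) * u = 0.
    by move=> xt e; rewrite !mulrBl xt -!mulrBl e mul0r.
  apply: cancel (branch_arrow_wt _) _.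
    by have := ltn_ord (tagged b); rewrite -ltnS prednK.
  rewrite [_ * 1]mulr1 -(gen_hornerC (tag b)) -gen_hornerB -gen_hornerB.
  rewrite [X in gen_horner _ X](_ : _ = 0) ?rmorph0 //.
  by rewrite /step_poly polyCB; ring.
rewrite [X in (X - _ - _) * _]sum_tgt_center.
rewrite [X in (_ - X - _) * _]sum_src_center.
rewrite subr0 -sum_polyA_gen.
rewrite [X in (X - _) * _](_ : _ = \sum_i polyA_gen P mu i) ?subrr ?mul0r //.
by apply: eq_bigr => i _; apply: loop_wt.
Qed.

(** The action on the summand at the center, where the right ideal is all of
    [A]. *)
Definition preproj_to_polyA (x : preproj lam) : A :=
  quot_lift (rep_entry star_wt None None) x.

Lemma rep_entry_center_ideal s : gen_ideal (fun r => r = preproj_relator lam) s ->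
  rep_entry star_wt None None s = 0.
Proof.
move=> s_ideal; rewrite -[LHS]mulr1 -[1]/(vertex_poly None).
apply: rep_entry_ideal s_ideal _ _; first exact: star_wt_vertex_poly.
by move=> _ ->; apply: star_relator_entries.
Qed.

Lemma preproj_to_polyAE r :
  preproj_to_polyA (quot_pi _ r) = rep_entry star_wt None None r.
Proof. by apply: quot_liftE => s; apply: rep_entry_center_ideal. Qed.

Lemma preproj_to_polyA_linear : linear preproj_to_polyA.
Proof. by apply: quot_lift_linear => s; apply: rep_entry_center_ideal. Qed.

Local Notation B := (preproj lam).
Local Notation E := (preproj_vtx lam (star_center d)).

(** * The map from A to the corner *)

Definition branch_up i k : B := oapp (preproj_star lam) 0 (branch_arrow d i k).
Definition branch_down i k : B := oapp (preproj_arr lam) 0 (branch_arrow d i k).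
Definition star_loop i : B := branch_down i 0 * branch_up i 0.

Lemma star_aaE i : star_aa d alpha mu i = star_loop i.
Proof.
rewrite /star_aa /star_loop /branch_down /branch_up /branch_arrow.
by case: insub => [k|] /=; [apply: quot_piM | rewrite [RHS]mulr0].
Qed.

Lemma branch_down_up i k : branch_down i k * branch_up i k =
  oapp (fun a => preproj_arr lam a * preproj_star lam a) 0 (branch_arrow d i k).
Proof. by rewrite /branch_down /branch_up; case: branch_arrow => //=; rewrite [LHS]mulr0. Qed.

Lemma qtgt_center i a : branch_arrow d i 0 = Some a -> @qtgt Q a = None.
Proof.
case: (ltnP 0 (d i).-1) => [lt0|/branch_arrow_ge-> //].
have [b -> [_ kb]] := branch_arrow_lt lt0; case=> <-.
by apply/eqP; rewrite star_tgt_eq_center kb.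
Qed.

Lemma center_mul_loop i : E * star_loop i = star_loop i.
Proof.
rewrite /star_loop [LHS]mulrA; congr (_ * _); rewrite /branch_down.
case def_a: branch_arrow => [a|] /=; last by rewrite [LHS]mulr0.
by rewrite preproj_vtx_arr (qtgt_center def_a).
Qed.

Lemma loop_mul_center i : star_loop i * E = star_loop i.
Proof.
rewrite /star_loop -[LHS]mulrA; congr (_ * _); rewrite /branch_up.
case def_a: branch_arrow => [a|] /=; last by rewrite [LHS]mul0r.
by rewrite preproj_star_vtx (qtgt_center def_a).
Qed.

Lemma sum_loop : \sum_i star_loop i = mu *: E.
Proof.
rewrite -[RHS](preproj_relation lam (star_center d)).
rewrite [X in X - _]sum_tgt_center.
rewrite [X in _ - X]sum_src_center [RHS]subr0.
by apply: eq_bigr => i _; apply: branch_down_up.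
Qed.

(** The idempotent of the vertex [(i, k + 1)], where the arrow [a_(i,k+1)]
    starts. *)
Definition end_vtx i k : B :=
  oapp (fun a : arrow Q => preproj_vtx lam (qsrc a)) 0 (branch_arrow d i k).

Lemma end_vtx_branch_up i k : end_vtx i k * branch_up i k = branch_up i k.
Proof.
rewrite /end_vtx /branch_up; case: branch_arrow => [a|] /=; last by rewrite [LHS]mulr0.
by rewrite preproj_vtx_star eqxx.
Qed.

Local Notation shift i k := ((alpha i)`_k *: (1 : B)).

Lemma shift_central i k (y : B) : shift i k * y = y * shift i k.
Proof.
by rewrite -[LHS]quot_scaleAl -[RHS]quot_scaleAr [1 * y]mul1r [y * 1]mulr1.
Qed.

Lemma branch_relation i k : (k < (d i).-1)%N ->
  branch_down i k.+1 * branch_up i k.+1 - branch_up i k * branch_down i k =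
  (shift i k - shift i k.+1) * end_vtx i k.
Proof.
case/branch_arrow_lt=> a def_a [ta ka].
rewrite -scalerBl -[RHS]quot_scaleAl [1 * _]mul1r.
rewrite [X in X - _]branch_down_up /branch_up /branch_down /end_vtx def_a /=.
have rel := preproj_relation lam (Some a : vertex Q).
rewrite [X in X - _]sum_tgt_arrow [X in _ - X]sum_src_arrow in rel.
by rewrite /= ka ta in rel.
Qed.

Lemma loop_comm i : star_loop i * E = E * star_loop i.
Proof. by rewrite loop_mul_center center_mul_loop. Qed.

Lemma branch_up_end i : branch_up i (d i).-1 = 0.
Proof. by rewrite /branch_up branch_arrow_ge. Qed.

Lemma loop_annihilator i : E * \prod_(j < d i) (star_loop i - shift i j) = 0.
Proof.
have := @branch_annihilator B (d i).-1 E (branch_up i) (branch_down i) (end_vtx i)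
  (fun k => shift i k) (preproj_vtxK _ _) (shift_central i) _ (loop_comm i)
  (@branch_relation i) (fun k _ => end_vtx_branch_up i k) (branch_up_end i).
by rewrite prednK //; apply; rewrite alpha0 scale0r.
Qed.

Lemma climb_loop i k : (k < d i)%N ->
  branch_down i k * branch_up i k * climb E (branch_up i) k =
  climb E (branch_up i) k * (star_loop i - shift i k).
Proof.
move=> lt_k; apply: (@climb_shift B (d i).-1 E (branch_up i) (branch_down i) (end_vtx i)
  (fun k => shift i k) (shift_central i) _ (loop_comm i) (@branch_relation i)
  (fun k _ => end_vtx_branch_up i k)); last by rewrite -ltnS prednK.
by rewrite alpha0 scale0r.
Qed.

Local Notation phi := (free_eval star_loop).

Lemma free_eval_center y : phi y * E = E * phi y.
Proof.
apply: (malg_linear_ext (f := fun y : free_alg K n => phi y * E)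
  (g := fun y : free_alg K n => E * phi y)) => [k a b|k a b|m].
- by rewrite free_evalD free_evalZ mulrDl quot_scaleAl.
- by rewrite free_evalD free_evalZ mulrDr quot_scaleAr.
rewrite -[<< 1 *g m >>]/(free_monom K m) free_eval_monom.
apply: (big_ind (fun y => y * E = E * y)) => [|y1 y2 h1 h2|i _].
- by rewrite [LHS]mul1r [RHS]mulr1.
- by rewrite -[LHS]mulrA h2 [LHS]mulrA h1 -[LHS]mulrA.
exact: loop_comm.
Qed.

Lemma free_eval_gen_shift i k :
  phi (free_gen K i - (alpha i)`_k *: 1) = star_loop i - shift i k.
Proof.
rewrite [LHS]linearB; congr (_ - _); first exact: free_eval_gen.
by rewrite /= free_evalZ rmorph1.
Qed.

(** The evaluation [x_i |-> a_i1 a_i1^*] is made unital by sending the empty word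
    to [1] instead of [E]; multiplying by [E], which commutes with the image,
    recovers the evaluation in the corner. *)
Lemma center_free_eval_ideal r :
  gen_ideal (polyA_rel P mu) r -> E * phi r = 0.
Proof.
have annl (R : pzRingType) (e u v : R) :
    u * e = e * u -> e * v = 0 -> e * (u * v) = 0.
  by move=> ue ev; rewrite mulrA -ue -mulrA ev mulr0.
elim=> {r} [_ [i|] ->||x y _ hx _ hy|a x _ hx|a x _ hx].
- rewrite P_fact -mul_polyC rmorphM rmorph_prod /= horner_algC.
  rewrite (_ : \prod_(j < d i) _ =
    \prod_(j < d i) (free_gen K i - (alpha i)`_j *: 1)); last first.
    by apply: eq_bigr => j _; rewrite rmorphB /= horner_algX horner_algC.
  rewrite rmorphM rmorph_prod /=.
  rewrite (eq_bigr (fun j : 'I_(d i) => star_loop i - shift i j)); last first.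
    by move=> j _; apply: free_eval_gen_shift.
  exact: annl (free_eval_center _) (loop_annihilator i).
- rewrite [phi _]linearB /= free_evalZ rmorph1 [phi _]linear_sum /=.
  rewrite (eq_bigr star_loop) => [|i _]; last by rewrite free_eval_gen.
  rewrite sum_loop [LHS]mulrBr; transitivity (mu *: E - mu *: E).
    congr (_ - _); rewrite -[LHS]quot_scaleAr; first by rewrite preproj_vtxK.
    by rewrite [E * 1]mulr1.
  exact: subrr.
- by rewrite linear0 [LHS]mulr0.
- by rewrite [phi _]free_evalD [LHS]mulrDr [X in X + _]hx [LHS]add0r.
- have -> : phi (a * x) = phi a * phi x by apply: free_evalM.
  exact: (annl B E (phi a) (phi x) (free_eval_center a) hx).
by rewrite [phi _]free_evalM [LHS]mulrA hx [LHS]mul0r.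
Qed.


(** * Surjectivity *)

(** The direct path from the center to [v]. *)
Definition vertex_climb (v : vertex Q) : B :=
  if v is Some a then climb E (branch_up (tag a)) (tagged a).+1 else E.

Lemma vertex_climb_tgt (a : arrow Q) :
  vertex_climb (qtgt a) = climb E (branch_up (tag a)) (tagged a).
Proof.
rewrite /= star_tgtE; case def_k: (tagged a : nat) => [|k] //=.
have lt_k : (k < (d (tag a)).-1)%N.
  by apply: leq_trans (ltn_ord (tagged a)); rewrite def_k.
by have [b -> [tb kb]] := branch_arrow_lt lt_k; rewrite /= kb tb.
Qed.

Lemma star_vertex_climb (a : arrow Q) :
  preproj_star lam a * vertex_climb (qtgt a) = vertex_climb (qsrc a).
Proof. by rewrite vertex_climb_tgt /= {2}/branch_up branch_arrowE. Qed.

Lemma arr_vertex_climb (a : arrow Q) :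
  preproj_arr lam a * vertex_climb (qsrc a) =
  vertex_climb (qtgt a) * (star_loop (tag a) - shift (tag a) (tagged a)).
Proof.
rewrite vertex_climb_tgt -climb_loop; last first.
  exact: leq_trans (ltn_ord (tagged a)) (leq_pred _).
by rewrite /= /branch_down branch_arrowE /= [LHS]mulrA.
Qed.

(** Induction on the number of arrows, removing the arrow travelled last. *)
Lemma path_climb v s (vs : @is_path Qd v s) :
    last v (map (@qsrc Qd) s) = None ->
  exists y, quot_pi _ (of_path K (QPath (qpath_val := (v, s)) vs)) =
            vertex_climb v * phi y :> B.
Proof.
elim: s v vs => [|b s IH] v vs /=.
  move=> v_center; exists 1; rewrite rmorph1 [RHS]mulr1.
  move: vs; rewrite v_center => vs; congr (quot_pi _ (of_path K _)).
  exact: val_inj.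
case/andP: (vs) => /eqP tb bs /(IH _ bs)[y yE]; subst v.
have -> : of_path K (QPath (qpath_val := (qtgt b, b :: s)) vs) =
    arr K b * of_path K (QPath (qpath_val := (qsrc b, s)) bs).
  rewrite of_pathM.
  have [r [-> rE _ _]] := @path_compP Qd (path_arrow b)
    (QPath (qpath_val := (qsrc b, s)) bs) erefl.
  by congr (of_path K _); apply: val_inj; rewrite rE.
suff [y' y'E] : exists y', quot_pi _ (arr K b) * (vertex_climb (qsrc b) * phi y)
    = vertex_climb (qtgt b) * phi y' :> B.
  by exists y'; rewrite -y'E -yE; apply: quot_piM.
case: b {vs bs yE} => a.
  exists ((free_gen K (tag a) - (alpha (tag a))`_(tagged a) *: 1) * y).
  rewrite [phi (_ * y)]free_evalM free_eval_gen_shift [LHS]mulrA [RHS]mulrA.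
  congr (_ * _); exact: arr_vertex_climb.
exists y; rewrite [LHS]mulrA; congr (_ * _); exact: star_vertex_climb.
Qed.

(** Written with [E] on both sides, the value lies in the corner by construction;
    [core_evalE] gives the form in which it is computed. *)
Definition core_eval (r : free_alg K n) : B := E * phi r * E.

Lemma core_eval_is_linear : linear core_eval.
Proof.
move=> k x y; rewrite /core_eval free_evalD free_evalZ [X in X * _]mulrDr [LHS]mulrDl.
by congr (_ + _); rewrite -[X in X * _]quot_scaleAr -[LHS]quot_scaleAl.
Qed.

HB.instance Definition _ :=
  GRing.isLinear.Build K (free_alg K n) B *:%R core_eval core_eval_is_linear.

Lemma core_evalE r : core_eval r = E * phi r.
Proof.
rewrite /core_eval -[LHS]mulrA free_eval_center [LHS]mulrA.
by congr (_ * _); apply: preproj_vtxK.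
Qed.

Lemma core_evalM r s : core_eval (r * s) = core_eval r * core_eval s.
Proof.
have aux (R : pzRingType) (e u v : R) :
    e * e = e -> u * e = e * u -> e * (u * v) = (e * u) * (e * v).
  by move=> ee ue; rewrite [RHS]mulrA -[e * u * e]mulrA ue !mulrA ee.
rewrite !core_evalE [phi (r * s)]free_evalM.
exact: aux (preproj_vtxK _ _) (free_eval_center r).
Qed.

(** Only the paths from the center to itself survive in [E * x * E], and for
    these the direct path in [path_climb] is trivial. *)
Lemma core_span x : exists r, E * quot_pi _ x * E = core_eval r.
Proof.
elim/path_alg_ind: x => [|x y [r hr] [s hs]|k p].
- exists 0; rewrite linear0 [X in X * _]mulr0 [LHS]mul0r; exact/esym/linear0.
- exists (r + s); rewrite quot_piD [X in X * _]mulrDr [LHS]mulrDl hr hs.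
  exact/esym/linearD.
suff [r hr] : exists r, E * quot_pi _ (of_path K p) * E = core_eval r.
  exists (k *: r); rewrite quot_piZ -[X in X * _]quot_scaleAr -[LHS]quot_scaleAl hr.
  exact/esym/linearZ.
have zero (z : B) : z = 0 -> exists r, z = core_eval r.
  by move=> ->; exists 0; apply/esym/linear0.
have [p_src|p_src] := eqVneq (path_src p) None; last first.
  apply: zero; rewrite -[LHS]mulrA -[X in _ * X]quot_piM of_pathM.
  rewrite path_comp_triv_r (negPf p_src) -[LHS]quot_piM mulr0; exact: linear0.
have [p_tgt|p_tgt] := eqVneq (path_tgt p) None; last first.
  apply: zero; rewrite -[X in X * _]quot_piM of_pathM.
  rewrite path_comp_triv_l eq_sym (negPf p_tgt) -[LHS]quot_piM mul0r.
  exact: linear0.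
case: p p_src p_tgt => [[v s] vs] p_src p_tgt.
have [r rE] := path_climb vs p_src; exists r.
rewrite rE /core_eval [X in X * _]mulrA; congr (_ * _ * _).
move: p_tgt; rewrite /path_tgt /= => ->; exact: preproj_vtxK.
Qed.

Definition polyA_core : A -> B := quot_lift core_eval.

Lemma polyA_coreE r : polyA_core (quot_pi _ r) = core_eval r.
Proof.
apply: quot_liftE => s /center_free_eval_ideal s0.
exact: etrans (core_evalE s) s0.
Qed.

Lemma polyA_core_corner x : polyA_core x \in corner_pred E.
Proof. by apply/asboolP; exists (phi (repr x)). Qed.

Definition polyA_corner (x : A) : preproj_corner lam (star_center d) :=
  Corner (polyA_core_corner x).

Lemma polyA_corner_linear : linear polyA_corner.
Proof.
move=> k x y; apply: val_inj; apply: quot_lift_linear => r.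
by move/center_free_eval_ideal; apply: etrans (core_evalE r).
Qed.

Lemma polyA_corner_monoid_morphism : monoid_morphism polyA_corner.
Proof.
split.
  apply: val_inj; rewrite /= -[1]/(quot_pi _ 1) polyA_coreE core_evalE rmorph1.
  exact: mulr1.
elim/quot_ind=> x; elim/quot_ind=> y; apply: val_inj.
rewrite -quot_piM [LHS]polyA_coreE core_evalM.
exact: esym (congr2 *%R (polyA_coreE x) (polyA_coreE y)).
Qed.

Lemma polyA_corner_gen i :
  corner_val (polyA_corner (polyA_gen P mu i)) = star_aa d alpha mu i.
Proof.
rewrite star_aaE [LHS]polyA_coreE core_evalE free_eval_gen; exact: center_mul_loop.
Qed.

Lemma polyA_corner_surj y : exists x, polyA_corner x = y.
Proof.
case: y => y y_corner; have /asboolP[b yE] := y_corner.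
elim/quot_ind: b yE => b yE; have [r rE] := core_span b.
exists (quot_pi _ r); apply: val_inj; rewrite [LHS]polyA_coreE -rE.
exact/esym.
Qed.

(** * Injectivity and conclusion *)

Lemma preproj_to_polyA_loop i y :
  preproj_to_polyA (star_loop i * y) = polyA_gen P mu i * preproj_to_polyA y.
Proof.
elim/quot_ind: y => r; rewrite /star_loop branch_down_up -loop_wt.
case def_a: branch_arrow => [a|] /=; last first.
  rewrite [X in preproj_to_polyA X]mul0r [RHS]mul0r.
  by rewrite -[0]/(quot_pi _ 0) preproj_to_polyAE linear0.
rewrite -[X in X * _]quot_piM -[X in preproj_to_polyA X]quot_piM.
have loop_entry u : rep_entry star_wt None u (@arr0 K Q a * @arr_star K Q a) =
    if u == None then star_wt (inl a) * star_wt (inr a) else 0.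
  rewrite [LHS]rep_entry_arrM //= -[star_tgt a]/(@qtgt Q a).
  by rewrite (qtgt_center def_a) [_ == u]eq_sym.
rewrite !preproj_to_polyAE [LHS]rep_entryM.
rewrite (eq_bigr (fun u => if u == None then
  star_wt (inl a) * star_wt (inr a) * rep_entry star_wt None None r else 0)).
  by rewrite -big_mkcond big_pred1_eq.
move=> u _; rewrite [X in X * _]loop_entry.
by case: eqP => [->|_] //; apply: mul0r.
Qed.

Lemma quot_pi_monom (s : seq 'I_n) :
  quot_pi _ (free_monom K (FMonom s)) = \prod_(i <- s) polyA_gen P mu i :> A.
Proof.
elim: s => [|i s IH]; first by rewrite big_nil -fmoneE.
rewrite big_cons -IH -quot_piM; congr (quot_pi _ _).
rewrite [RHS]free_monomM; congr (free_monom K _).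
by apply: val_inj; rewrite /= fmM fmU.
Qed.

(** [a_i1 a_i1^*] acts at the center as left multiplication by [x_i], so a word
    in these loops acts as the same word in the [x_i]. *)
Lemma core_evalK r : preproj_to_polyA (core_eval r) = quot_pi _ r.
Proof.
apply: (malg_linear_ext (f := fun r : free_alg K n => preproj_to_polyA (core_eval r))
  (g := fun r : free_alg K n => quot_pi _ r)) => [k a b|k a b|[s]].
- by rewrite core_eval_is_linear preproj_to_polyA_linear.
- exact: quot_pi_is_linear.
rewrite core_evalE -free_eval_center -[<< 1 *g _ >>]/(free_monom K (FMonom s)).
rewrite quot_pi_monom free_eval_monom /=.
elim: s => [|i s IH].
  rewrite !big_nil [1 * _]mul1r preproj_to_polyAE.
  exact: rep_entry_vtx.
by rewrite !big_cons -mulrA preproj_to_polyA_loop IH.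
Qed.

Lemma polyA_corner_bij : bijective polyA_corner.
Proof.
have polyA_cornerK : cancel polyA_corner (fun y => preproj_to_polyA (corner_val y)).
  elim/quot_ind=> r; rewrite /= polyA_coreE; exact: core_evalK.
exists (fun y => preproj_to_polyA (corner_val y)) => // y.
by have [x <-] := polyA_corner_surj y; rewrite polyA_cornerK.
Qed.

End StarCorner.

Lemma poly_roots_fact (F : closedFieldType) (p : {poly F}) (s : seq F) :
    p != 0 -> (forall z, count_mem z s = mup z p) ->
  p = lead_coef p *: \prod_(j < (size p).-1) ('X - (s`_j)%:P).
Proof.
move=> p_neq0 count_s; have [r def_p] := closed_field_poly_normal p.
have lc_neq0 : lead_coef p != 0 by rewrite lead_coef_eq0.
have perm_rs : perm_eq r s.
  apply/allP => z _ /=; apply/eqP; rewrite count_s def_p -mul_polyC.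
  by rewrite mupMr ?rootC // mu_prod_XsubC.
have size_p : (size p).-1 = size s.
  by rewrite def_p size_scale // size_prod_XsubC (perm_size perm_rs).
by rewrite {1}def_p (perm_big _ perm_rs) (big_nth 0) big_mkord size_p.
Qed.

Theorem theorem1 (R : realType) (n : nat) (P : 'I_n -> {poly R[i]}) (mu : R[i])
    (alpha : 'I_n -> seq R[i])
    (P_nonconst : forall i : 'I_n, (1 < size (P i))%N)
    (P_at0 : forall i : 'I_n, (P i).[0] = 0)
    (alpha_roots : forall (i : 'I_n) (z : R[i]),
       count_mem z (alpha i) = mup z (P i))
    (alpha_0 : forall i : 'I_n, (alpha i)`_0 = 0) :
  let d := fun i : 'I_n => (size (P i)).-1 in
  exists f : polyA P mu ->
             preproj_corner (star_weight (d := d) alpha mu) (star_center d),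
    [/\ linear f, monoid_morphism f, bijective f
      & forall i : 'I_n,
          corner_val (f (polyA_gen P mu i)) = star_aa d alpha mu i].
Proof.
move=> d.
have P_neq0 i : P i != 0 by rewrite -size_poly_gt0 ltnW.
have d_gt0 i : (0 < d i)%N by rewrite /d -ltnS prednK // ltnW.
have c_neq0 i : lead_coef (P i) != 0 by rewrite lead_coef_eq0.
have P_fact i := poly_roots_fact (P_neq0 i) (alpha_roots i).
exists (@polyA_corner _ n d P mu alpha); split.
- exact: polyA_corner_linear d_gt0 P_fact alpha_0.
- exact: polyA_corner_monoid_morphism d_gt0 P_fact alpha_0.
- exact: polyA_corner_bij d_gt0 c_neq0 P_fact alpha_0.
- exact: polyA_corner_gen d_gt0 P_fact alpha_0.
Qed.
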